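(* Let $r\ge 3$, let $W$ be the Weyl group of type $C_r$, let $\tilde\alpha$ be the highest root and $\varpi_2=\alpha_1+2\alpha_2+\cdots+2\alpha_{r-1}+\alpha_r$ the second fundamental weight, and let $\mathcal C_r(\tilde\alpha,\varpi_2)=\{\sigma\in W:\wp(\sigma(\tilde\alpha+\rho)-(\varpi_2+\rho))>0\}$. Let $\sigma\in W$. Then $\sigma\in\mathcal C_r(\tilde\alpha,\varpi_2)$ if and only if $\sigma=1$.
   Context: Type $C_r$ ($\mathfrak{sp}_{2r}(\mathbb C)$): simple roots $\alpha_i=\varepsilon_i-\varepsilon_{i+1}$ for $1\le i\le r-1$ and $\alpha_r=2\varepsilon_r$; positive roots $\Phi^+=\{\varepsilon_i-\varepsilon_j,\varepsilon_i+\varepsilon_j:1\le i<j\le r\}\cup\{2\varepsilon_i:1\le i\le r\}$; highest root $\tilde\alpha=2\alpha_1+2\alpha_2+\cdots+2\alpha_{r-1}+\alpha_r$; $\rho=\frac12\sum_{\alpha\in\Phi^+}\alpha$. $\wp(\xi)$ is Kostant's partition function: the number of ways $\xi$ may be written as a nonnegative integral sum of positive roots. *)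

(* Defs.v *)
From HB Require Import structures.
From mathcomp Require Import all_boot all_order all_algebra.
From mathcomp Require Import finmap.
From mathcomp Require Import all_classical.

Set Implicit Arguments.
Unset Strict Implicit.
Unset Printing Implicit Defensive.

Import Order.TTheory GRing.Theory Num.Theory.

Local Open Scope fset_scope.
Local Open Scope ring_scope.

(* Indices run from 1 to r, as in the usual labelling of the Dynkin diagram;
   [eps r k] is the zero vector when k is outside this range. *)
Definition eps (r k : nat) : 'cV[rat]_r := \col_(i < r) (i.+1 == k)%:R.

Definition simple_root (r k : nat) : 'cV[rat]_r :=
  if (k < r)%N then eps r k - eps r k.+1 else 2 *: eps r r.

Definition pos_roots (r : nat) : {fset 'cV[rat]_r} :=
  [fset v in
    [seq eps r i - eps r j | i <- index_iota 1 r.+1, j <- index_iota i.+1 r.+1]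
    ++
    [seq eps r i + eps r j | i <- index_iota 1 r.+1, j <- index_iota i.+1 r.+1]
    ++
    [seq 2 *: eps r i | i <- index_iota 1 r.+1]].

Definition rho (r : nat) : 'cV[rat]_r :=
  2^-1 *: \sum_(a : pos_roots r) val a.

Definition highest_root (r : nat) : 'cV[rat]_r :=
  \sum_(1 <= i < r) 2 *: simple_root r i + simple_root r r.

Definition varpi2 (r : nat) : 'cV[rat]_r :=
  simple_root r 1 + \sum_(2 <= i < r) 2 *: simple_root r i + simple_root r r.

Definition dot (r : nat) (u v : 'cV[rat]_r) : rat :=
  \sum_(i < r) u i 0 * v i 0.

(* Matrix of v |-> v - 2 (v, a) / (a, a) a, acting on column vectors. *)
Definition reflection (r : nat) (a : 'cV[rat]_r) : 'M[rat]_r :=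
  1%:M - (2 / dot a a) *: (a *m a^T).

(* The generators are involutions, so closure under left multiplication by
   them gives the whole group that they generate. *)
Inductive weyl (r : nat) : 'M[rat]_r -> Prop :=
| weyl_one : weyl 1%:M
| weyl_mul (k : nat) (s : 'M[rat]_r) :
    (1 <= k <= r)%N -> weyl s -> weyl (reflection (simple_root r k) *m s).

Definition root_partitions (r : nat) (xi : 'cV[rat]_r) :
    set {ffun pos_roots r -> nat} :=
  [set m | \sum_(a : pos_roots r) val a *+ m a = xi]%classic.

(* Pairing with (r, r - 1, .., 1), which is at least 1 on positive roots. *)
Definition ht (r : nat) (v : 'cV[rat]_r) : rat :=
  \sum_(i < r) (r - i)%:R * v i 0.

Fact ht_is_semilinear (r : nat) : semilinear (@ht r : 'cV[rat]_r -> rat^o).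
Proof.
split=> [c u|u v]; rewrite /ht.
  by rewrite scaler_sumr; apply: eq_bigr => i _; rewrite mxE mulrCA.
by rewrite -big_split; apply: eq_bigr => i _; rewrite mxE mulrDr.
Qed.

HB.instance Definition _ (r : nat) :=
  GRing.isSemilinear.Build rat 'cV[rat]_r rat^o *:%R (@ht r)
    (@ht_is_semilinear r).

Lemma ht_eps (r k : nat) : (1 <= k <= r)%N -> ht (eps r k) = (r.+1 - k)%:R.
Proof.
case: k => // k /= ltkr; rewrite /ht (bigD1 (Ordinal ltkr)) //= !mxE eqxx mulr1.
rewrite big1 ?addr0 ?subSS // => i; rewrite -val_eqE /= => /negbTE ne_ik.
by rewrite mxE eqSS ne_ik mulr0.
Qed.

Lemma ht_pos_root (r : nat) (v : 'cV[rat]_r) : v \in pos_roots r -> 1 <= ht v.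
Proof.
have ij_rng i j : i \in index_iota 1 r.+1 -> j \in index_iota i.+1 r.+1 ->
    [/\ (1 <= i <= r)%N, (1 <= j <= r)%N & (i < j)%N].
  rewrite !mem_index_iota !ltnS => /andP[i1 ir] /andP[ij jr].
  by split=> //; apply/andP; split=> //; apply: leq_trans ij.
rewrite !inE => /or3P[/allpairsPdep|/allpairsPdep|/mapP].
- move=> [i [j [/ij_rng h /h[ir jr ij] ->]]].
  rewrite linearB /= !ht_eps // lerBrDr nat1r ler_nat.
  by apply: ltn_sub2l => //; rewrite ltnS; case/andP: ir.
- move=> [i [j [/ij_rng h /h[ir jr ij] ->]]].
  rewrite linearD /= !ht_eps // -natrD ler1n.
  by case/andP: ir => _ ir; rewrite addn_gt0 subn_gt0 ltnS ir.
- move=> [i]; rewrite mem_index_iota ltnS => ir ->.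
  rewrite linearZ /= ht_eps // /GRing.scale /= -natrM ler1n.
  by case/andP: ir => _ ir; rewrite muln_gt0 subn_gt0 ltnS.
Qed.

Lemma finite_root_partitions (r : nat) (xi : 'cV[rat]_r) :
  finite_set (root_partitions xi).
Proof.
pose N := Num.bound (ht xi).
pose f (g : {ffun pos_roots r -> 'I_N.+1}) : {ffun pos_roots r -> nat} :=
  [ffun a => val (g a)].
apply: (@sub_finite_set _ _ (f @` setT)%classic); last first.
  by apply: finite_image; exact: finite_finset.
move=> m /= hm.
exists [ffun a => inord (m a)] => //; apply/ffunP => a; rewrite !ffunE /=.
have hge b : (m b)%:R <= ht (val b) *+ m b :> rat.
  by apply: ler_wMn2r; apply: ht_pos_root; apply: valP.
have le_ma : (m a)%:R <= ht xi.
  rewrite -hm linear_sum (bigD1 a) //= raddfMn /=.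
  rewrite -[leLHS]addr0 lerD ?hge // sumr_ge0 // => b _.
  by rewrite raddfMn /=; apply: le_trans (hge b); rewrite ler0n.
rewrite inordK // ltnS -(ler_nat rat); apply: le_trans (le_ma) _; apply/ltW.
by apply: archi_boundP; apply: le_trans le_ma; rewrite ler0n.
Qed.

(* [fset_set] is the set itself when it is finite and empty otherwise; the
   set here is always finite, see [finite_root_partitions]. *)
Definition kostant (r : nat) (xi : 'cV[rat]_r) : nat :=
  #|` fset_set (root_partitions xi)|.

Definition weyl_alternation_set (r : nat) (lambda mu : 'cV[rat]_r) :
    set 'M[rat]_r :=
  [set s | weyl s /\
     (0 < kostant (s *m (lambda + rho r) - (mu + rho r)))%N]%classic.

(* Main.v *)
Require Import Defs.
From mathcomp Require Import all_boot all_order all_algebra.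
From mathcomp Require Import finmap fingroup perm.
From mathcomp Require Import all_classical.
From mathcomp Require Import ring lra zify.
Import GRing.Theory Num.Theory Order.TTheory.
Local Open Scope ring_scope.

(** Put x = highest root + rho.  In the coordinates of the eps basis the highest
    root is 2 eps_1, the weight varpi_2 is eps_1 + eps_2 and
    rho = (r, r - 1, .., 1) ([highest_rootE], [varpi2E], [rhoE]), so
    x = (r + 2, r - 1, r - 2, .., 1) and x - (varpi_2 + rho) = eps_1 - eps_2.
    The latter is a positive root, which gives one direction.

    For the converse, every prefix sum v_1 + .. + v_k is nonnegative on positive
    roots, hence on every vector that has a root partition
    ([prefix_sum_root_partition]); and the Weyl group acts by signed
    permutations of the coordinates ([weyl_signed_perm]).  If
    sigma x - x + (eps_1 - eps_2) has a partition, then for each k the sum of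
    the first k coordinates of sigma x is at least that of x, up to an error
    of 1 when k = 1.  As x is positive and decreasing, a signed permutation that
    has left the earlier coordinates alone can only reach x_k by also leaving
    the k-th one alone; the error at k = 1 is harmless because the gap between
    r + 2 and r - 1 exceeds it.  So sigma fixes the coordinates one after the
    other ([signed_perm_eq1_of_prefix_sum]). *)

Set Implicit Arguments.
Unset Strict Implicit.

(** * Coordinates and indices *)

Lemma epsE (r : nat) (i : 'I_r) : eps r i.+1 = delta_mx i 0.
Proof. by apply/colP => j; rewrite !mxE eqSS eqxx andbT val_eqE. Qed.

Lemma index_ord (r k : nat) : (1 <= k <= r)%N -> exists i : 'I_r, k = i.+1.
Proof. by case: k => // k kr; exists (Ordinal kr). Qed.

Lemma index_pair_bounds (r i j : nat) :
  i \in index_iota 1 r.+1 -> j \in index_iota i.+1 r.+1 ->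
  [/\ (1 <= i <= r)%N, (1 <= j <= r)%N & (i < j)%N].
Proof. by rewrite !mem_index_iota => ? ?; split; lia. Qed.

(** * Root partitions and prefix sums *)

Lemma kostant_gt0 (r : nat) (xi : 'cV[rat]_r) :
  (0 < kostant xi)%N <-> exists m, root_partitions xi m.
Proof.
rewrite /kostant cardfs_gt0; split.
  case/fset0Pn => m; rewrite in_fset_set; last exact: finite_root_partitions.
  by move/set_mem; exists m.
case=> m mP; apply/fset0Pn; exists m.
by rewrite in_fset_set; [exact: mem_set | exact: finite_root_partitions].
Qed.

(** For k < r this is the pairing with the k-th fundamental coweight, and for
    k = r with twice the r-th one; nonnegativity of all of them describes the
    cone spanned by the positive roots. *)
Definition prefix_sum {r : nat} (k : nat) (v : 'cV[rat]_r) : rat :=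
  \sum_(i < r | (i < k)%N) v i 0.

Lemma prefix_sumD r k (u v : 'cV[rat]_r) :
  prefix_sum k (u + v) = prefix_sum k u + prefix_sum k v.
Proof. by rewrite /prefix_sum -big_split; apply: eq_bigr => i _; rewrite mxE. Qed.

Lemma prefix_sumZ r k c (v : 'cV[rat]_r) :
  prefix_sum k (c *: v) = c * prefix_sum k v.
Proof. by rewrite /prefix_sum mulr_sumr; apply: eq_bigr => i _; rewrite mxE. Qed.

Lemma prefix_sumB r k (u v : 'cV[rat]_r) :
  prefix_sum k (u - v) = prefix_sum k u - prefix_sum k v.
Proof. by rewrite -scaleN1r prefix_sumD prefix_sumZ mulN1r. Qed.

Lemma prefix_sum_eps r k l : (1 <= l <= r)%N ->
  prefix_sum k (eps r l) = (l <= k)%N%:R.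
Proof.
move=> /index_ord[i ->]; rewrite epsE /prefix_sum big_mkcond (bigD1 i) //=.
rewrite big1 => [|j /negbTE ji]; last by rewrite mxE ji if_same.
by rewrite addr0 mxE !eqxx; case: ltnP.
Qed.

(** Each root eps_i - eps_j has its +1 before its -1; the other positive roots
    have no negative coordinate. *)
Lemma prefix_sum_pos_root r k v : v \in pos_roots r -> 0 <= prefix_sum k v.
Proof.
rewrite !inE => /or3P[/allpairsPdep|/allpairsPdep|/mapP].
- move=> [i [j [/index_pair_bounds h /h[ir jr ij] ->]]].
  by rewrite prefix_sumB !prefix_sum_eps // subr_ge0 ler_nat; lia.
- move=> [i [j [/index_pair_bounds h /h[ir jr ij] ->]]].
  by rewrite prefix_sumD !prefix_sum_eps // addr_ge0.
- move=> [i]; rewrite mem_index_iota ltnS => ir ->.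
  by rewrite prefix_sumZ prefix_sum_eps // mulr_ge0.
Qed.

Lemma prefix_sum_root_partition r k (xi : 'cV[rat]_r) m :
  root_partitions xi m -> 0 <= prefix_sum k xi.
Proof.
move=> <-; apply: (big_ind (fun v => 0 <= prefix_sum k v)).
- by rewrite /prefix_sum big1 // => i _; rewrite mxE.
- by move=> u v hu hv; rewrite prefix_sumD addr_ge0.
- move=> a _; rewrite -scaler_nat prefix_sumZ mulr_ge0 //.
  by apply: prefix_sum_pos_root; apply: valP.
Qed.

(** * The weights rho, highest root and varpi_2 in coordinates *)

(** Needed to turn the sum over the set of positive roots, which defines rho,
    into a sum over indices.  The first family is separated from the other
    two by the sum of all coordinates (0 against 2), the second from the third
    by the coordinate at the smaller index (1 against an even number), and
    inside a family the indices are read off from the nonzero coordinates. *)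
Lemma pos_roots_uniq r :
  uniq ([seq eps r i - eps r j | i <- index_iota 1 r.+1, j <- index_iota i.+1 r.+1]
    ++ [seq eps r i + eps r j | i <- index_iota 1 r.+1, j <- index_iota i.+1 r.+1]
    ++ [seq 2 *: eps r i | i <- index_iota 1 r.+1]).
Proof.
have at_ l (u v : 'cV[rat]_r) : (1 <= l <= r)%N -> u = v ->
    exists2 i : 'I_r, l = i.+1 & u i 0 = v i 0.
  by move=> /index_ord[i ->] ->; exists i.
rewrite !cat_uniq; apply/and5P; split.
- apply: allpairs_uniq_dep; rewrite ?iota_uniq //.
    by move=> i _; rewrite iota_uniq.
  move=> _ _ /allpairsPdep[i [j [hi hj ->]]] /allpairsPdep[k [l [hk hl ->]]] /=.
  have [ir jr ij] := index_pair_bounds hi hj.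
  have [kr lr kl] := index_pair_bounds hk hl => E.
  have [a Ea] := at_ i _ _ ir E; have [b Eb] := at_ j _ _ jr E.
  have Eij : i == j = false by lia.
  rewrite !mxE -Ea -Eb !eqxx Eij (eq_sym j) Eij => Hj Hi.
  have -> : i = k by apply/eqP; move: Hi; case: (i == k); case: (i == l).
  have -> // : j = l by apply/eqP; move: Hj; case: (j == l); case: (j == k).
- apply/hasPn => v; rewrite mem_cat => vP; apply/negP.
  move=> /allpairsPdep[i [j [hi hj Ev]]].
  have [ir jr ij] := index_pair_bounds hi hj.
  have : prefix_sum r v = 0.
    rewrite Ev prefix_sumB !prefix_sum_eps //.
    by case/andP: ir jr => _ -> /andP[_ ->].
  apply/eqP; case/orP: vP.
    move=> /allpairsPdep[k [l [hk hl ->]]].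
    have [kr lr kl] := index_pair_bounds hk hl.
    rewrite prefix_sumD !prefix_sum_eps //.
    by case/andP: kr lr => _ -> /andP[_ ->].
  move=> /mapP[k]; rewrite mem_index_iota ltnS => kr ->.
  by rewrite prefix_sumZ !prefix_sum_eps //; case/andP: kr => _ ->.
- apply: allpairs_uniq_dep; rewrite ?iota_uniq //.
    by move=> i _; rewrite iota_uniq.
  move=> _ _ /allpairsPdep[i [j [hi hj ->]]] /allpairsPdep[k [l [hk hl ->]]] /=.
  have [ir jr ij] := index_pair_bounds hi hj.
  have [kr lr kl] := index_pair_bounds hk hl => E.
  have [a Ea] := at_ i _ _ ir E; have [b Eb] := at_ j _ _ jr E.
  rewrite !mxE -Ea -Eb !eqxx => Hj Hi.
  have Hi' : (i == k) || (i == l).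
    by move: Hi; case: (i == k); case: (i == l); case: (i == j).
  have Hj' : (j == k) || (j == l).
    by move: Hj; case: (j == k); case: (j == l); case: (j == i).
  have [-> ->] // : i = k /\ j = l by lia.
- apply/hasPn => v /mapP[k]; rewrite mem_index_iota ltnS => kr ->; apply/negP.
  move=> /allpairsPdep[i [j [hi hj E]]].
  have [ir jr ij] := index_pair_bounds hi hj.
  have [a Ea] := at_ i _ _ ir E.
  have Eij : i == j = false by lia.
  by rewrite !mxE -Ea eqxx Eij; case: (i == k).
- rewrite map_inj_in_uniq ?iota_uniq // => i j.
  rewrite !mem_index_iota !ltnS => ir jr E.
  have [a Ea] := at_ i _ _ ir E.
  by rewrite !mxE -Ea eqxx; case: eqP.
Qed.

(** Grouping the roots by their smaller index k, the pairs eps_k - eps_l and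
    eps_k + eps_l contribute 2 eps_k for each of the r - k values of l, and
    2 eps_k itself contributes once more; k = i + 1 for the coordinate i. *)
Lemma rhoE r (i : 'I_r) : rho r i 0 = (r - i)%:R.
Proof.
rewrite /rho -(big_seq_fsetE _ (pos_roots r) predT (fun a => a)) /=.
rewrite (perm_big _ (uniq_perm (fset_uniq _) (pos_roots_uniq r) _)) /=;
  last first.
  by move=> v; rewrite !inE !mem_cat.
rewrite !big_cat /= !big_allpairs_dep big_map addrA -big_split /= -big_split /=.
rewrite (eq_big_nat _ _ (F2 := fun k => 2 *: ((r.+1 - k)%:R *: eps r k)));
  last first.
  move=> k /andP[_ kr]; rewrite -big_split /=.
  rewrite (eq_bigr (fun=> 2 *: eps r k)) => [|l _]; last first.
    by rewrite addrACA addNr addr0 scaler_nat mulr2n.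
  rewrite sumr_const_nat subSS subSn // -scaler_nat !scalerA -scalerDl.
  by congr (_ *: _); rewrite -natr1; ring.
rewrite -scaler_sumr scalerA mulVf // scale1r big_add1 big_mkord summxE.
rewrite (bigD1 i) //= big1 => [|j /negbTE ji]; last first.
  by rewrite epsE !mxE eq_sym ji mulr0.
by rewrite epsE !mxE !eqxx mulr1 addr0 subSS.
Qed.

Lemma sum_simple_rootE r k : (k <= r)%N ->
  \sum_(k <= i < r) simple_root r i = eps r k - eps r r.
Proof.
move=> kr; rewrite -opprB -telescope_sumr // -sumrN.
by apply: eq_big_nat => i /andP[_ ir]; rewrite /simple_root ir opprB.
Qed.

Lemma highest_rootE r : (1 <= r)%N -> highest_root r = 2 *: eps r 1.
Proof.
move=> r0; rewrite /highest_root -scaler_sumr sum_simple_rootE //.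
by rewrite /simple_root ltnn -scalerDr subrK.
Qed.

Lemma varpi2E r : (2 <= r)%N -> varpi2 r = eps r 1 + eps r 2.
Proof.
move=> r2; rewrite /varpi2 -scaler_sumr sum_simple_rootE //.
rewrite /simple_root ltnn r2 -addrA -scalerDr.
by rewrite subrK scaler_nat mulr2n addrA subrK.
Qed.

(** * The Weyl group as signed permutations *)

Lemma reflectionE r (a v : 'cV[rat]_r) :
  reflection a *m v = v - (2 / dot a a * dot a v) *: a.
Proof.
rewrite /reflection mulmxBl mul1mx -scalemxAl -mulmxA -scalerA; congr (_ - _ *: _).
apply/colP => i; rewrite !mxE big_ord1 !mxE mulrC; congr (_ * _).
by apply: eq_bigr => j _; rewrite !mxE.
Qed.

Lemma dot_eps r (i : 'I_r) (v : 'cV[rat]_r) : dot (eps r i.+1) v = v i 0.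
Proof.
rewrite /dot (bigD1 i) //= mxE eqxx mul1r big1 ?addr0 // => j ji.
by rewrite mxE eqSS val_eqE (negbTE ji) mul0r.
Qed.

Lemma dotBl r (u v w : 'cV[rat]_r) : dot (u - v) w = dot u w - dot v w.
Proof. by rewrite /dot -sumrB; apply: eq_bigr => i _; rewrite !mxE mulrBl. Qed.

Lemma dotZl r c (u w : 'cV[rat]_r) : dot (c *: u) w = c * dot u w.
Proof. by rewrite /dot mulr_sumr; apply: eq_bigr => i _; rewrite !mxE mulrA. Qed.

Definition signed_perm r (s : 'M[rat]_r) (p : 'S_r) (e : 'I_r -> bool) :=
  forall (v : 'cV[rat]_r) i, (s *m v) i 0 = (-1) ^+ e i * v (p i) 0.

(** The reflection in eps_k - eps_(k+1) exchanges two adjacent coordinates and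
    the one in 2 eps_r changes the sign of the last coordinate. *)
Lemma simple_reflection_signed_perm r k : (1 <= k <= r)%N ->
  exists p e, signed_perm (reflection (simple_root r k)) p e.
Proof.
move=> kr; have [i Ei] := index_ord kr; rewrite /simple_root.
case: ltnP => [ltkr|lerk]; last first.
  exists 1%g, (fun j => j == i) => v j.
  have -> : eps r r = eps r i.+1 by congr eps; lia.
  rewrite reflectionE !dotZl !dot_eps perm1 !mxE eqxx eqSS val_eqE.
  by case: eqP => [->|_] /=; rewrite ?expr0 ?expr1; field.
have [j Ej] : exists j : 'I_r, k.+1 = j.+1 by apply: index_ord.
have ij : (i == j) = false by rewrite -val_eqE /=; lia.
exists (tperm i j), (fun=> false) => v l; rewrite expr0 mul1r Ej Ei.
rewrite reflectionE !dotBl !dot_eps !mxE !eqxx !eqSS !val_eqE ij (eq_sym j) ij.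
case: tpermP => [->|->|/eqP/negbTE -> /eqP/negbTE ->].
- by rewrite eqxx ij; field.
- by rewrite eqxx (eq_sym j) ij; field.
- by field.
Qed.

Lemma weyl_signed_perm r (s : 'M[rat]_r) :
  weyl s -> exists p e, signed_perm s p e.
Proof.
elim=> [|k {}s kr _ [p [e ps]]].
  by exists 1%g, (fun=> false) => v i; rewrite mul1mx perm1 mul1r.
have [q [f qf]] := simple_reflection_signed_perm kr.
exists (q * p)%g, (fun i => f i (+) e (q i)) => v i.
by rewrite -mulmxA qf ps mulrA -signr_addb permM.
Qed.

(** * Rigidity of the identity *)

Lemma signed_perm_eq1 r (s : 'M[rat]_r) p e : signed_perm s p e ->
  (forall i, p i = i /\ e i = false) -> s = 1%:M.
Proof.
move=> sp fix_pe; apply/matrixP => i j.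
have [pi ei] := fix_pe i; have := sp (delta_mx j 0) i.
by rewrite -colE pi ei expr0 mul1r !mxE eqxx andbT => ->; rewrite eq_sym.
Qed.

(** Here d is the slack allowed in each prefix sum.  Suppose that s fixes the
    coordinates before i.  Then only coordinate i contributes to the prefix sum
    of s x - x ending at i, and its value in s x is, up to sign, an entry of x at
    some position p i >= i.  A negative sign would make it too small since
    x i > d i, and p i > i would make it too small by the gap hypothesis. *)
Lemma signed_perm_eq1_of_prefix_sum r (s : 'M[rat]_r) p e (x : 'cV[rat]_r)
    (d : 'I_r -> rat) :
  signed_perm s p e ->
  (forall i, 0 <= d i) -> (forall i, d i < x i 0) ->
  (forall i j : 'I_r, (i < j)%N -> x j 0 + d i < x i 0) ->
  (forall i : 'I_r, 0 <= prefix_sum i.+1 (s *m x - x) + d i) ->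
  s = 1%:M.
Proof.
move=> sp d_ge0 d_lt gap dom; apply: (signed_perm_eq1 sp) => i.
have [n] := ubnP (val i); elim: n i => // n IHn i; rewrite ltnS => le_in.
have {}IHn (j : 'I_r) : (j < i)%N -> p j = j /\ e j = false.
  by move=> ji; apply: IHn; apply: leq_trans ji le_in.
have le_ipi : (i <= p i)%N.
  rewrite leqNgt; apply/negP => lt_pii; have [/perm_inj ppi _] := IHn _ lt_pii.
  by rewrite ppi ltnn in lt_pii.
have := dom i; rewrite /prefix_sum (bigD1 i) //= big1 => [|j]; last first.
  case/andP; rewrite ltnS => le_ji ne_ji.
  have [pj ej] : p j = j /\ e j = false by apply: IHn; rewrite ltn_neqAle ne_ji.
  by rewrite mxE sp pj ej mul1r mxE subrr.
rewrite addr0 mxE sp mxE; have xi := d_lt i; have xpi := d_lt (p i).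
have := d_ge0 i; have := d_ge0 (p i).
case: (e i) => /=; rewrite ?expr0 ?expr1 ?mulN1r ?mul1r.
  by move=> *; exfalso; lra.
split=> //; apply/eqP; rewrite eq_sym -val_eqE eqn_leq le_ipi /= leqNgt.
by apply/negP => /gap; lra.
Qed.

(** * The alternation set *)

Theorem theorem8p9 (r : nat) (r_ge3 : (3 <= r)%N) (sigma : 'M[rat]_r)
    (sigma_W : weyl sigma) :
  weyl_alternation_set (highest_root r) (varpi2 r) sigma <-> sigma = 1%:M.
Proof.
have r1 : (1 <= r)%N by lia.
have r2 : (2 <= r)%N by lia.
pose x := highest_root r + rho r.
have diffE s : s *m x - (varpi2 r + rho r) = (s *m x - x) + (eps r 1 - eps r 2).
  rewrite /x highest_rootE // varpi2E //.
  move: (rho r) => v; move: (s *m _) => u.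
  by apply/colP => i; rewrite !mxE; ring.
have xE (i : 'I_r) : x i 0 = ((r - i) + (i == 0%N :> nat).*2)%:R.
  by rewrite mxE highest_rootE // rhoE !mxE eqSS addrC natrD -mul2n natrM.
split=> [[_ /kostant_gt0[m mP]]|->].
  have [p [e sp]] := weyl_signed_perm sigma_W.
  (* The slack is the prefix sum of eps_1 - eps_2: 1 after one coordinate and
     0 from the second on. *)
  apply: (@signed_perm_eq1_of_prefix_sum _ _ p e x
            (fun i => (i == 0%N :> nat)%:R)) => //.
  - by move=> i; rewrite xE ltr_nat; have := ltn_ord i; case: eqP => /=; lia.
  - move=> i j ij; rewrite !xE -natrD ltr_nat; have := ltn_ord j; move: ij.
    by case: eqP; case: eqP => /=; lia.
  - move=> i; have := prefix_sum_root_partition i.+1 mP.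
    rewrite -/x diffE prefix_sumD prefix_sumB !prefix_sum_eps //.
    by case: i => [[|i] lt_ir] /=; rewrite ?subrr ?subr0.
split; first exact: weyl_one.
rewrite -/x diffE mul1mx subrr add0r; apply/kostant_gt0.
have aP : eps r 1 - eps r 2 \in pos_roots r.
  rewrite !inE; apply/or3P/Or31/allpairsPdep; exists 1%N, 2%N.
  by rewrite !mem_index_iota.
exists [ffun b => (b == [` aP]%fset : nat)].
rewrite /root_partitions /= (bigD1 [` aP]%fset) //= ffunE eqxx mulr1n.
rewrite big1 ?addr0 // => b /negbTE b_ne.
by rewrite ffunE b_ne.
Qed.
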